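(* Let $m\ge1$, $n\ge2$, and let $A\in\mathbb{R}^{m\times n}$, $b\in\mathbb{R}^m$, $c\in\mathbb{R}^n$ be arbitrary such that the integer program $\max\{\langle c,x\rangle:Ax\le b,\ x\in\{0,1\}^n\}$ is feasible. Let $\mathrm{IPGap}$ be its integrality gap, let $C:=\frac{n}{\log n}\cdot\mathrm{IPGap}$, let $(x^*,\lambda^* )$ be a saddle point of the Lagrangian of the LP relaxation, and let $J_\ell$ ($\ell\ge1$) and $J_{\mathrm{rem}}$ be the associated sets of items (defined in the context). Then the tree of the best-bound branch-and-bound algorithm applied to this instance has at most $$2\left(2^{|J_{\mathrm{rem}}|}\cdot\prod_{\ell=1}^{\log C}\binom{|J_\ell|}{\le C/2^\ell}\right)n+1$$ nodes.
   Context: Logarithms are base 2; $[n]=\{1,\dots,n\}$; $A^j$ is the $j$th column of $A$. For an integer $a\ge0$ and real $k\ge0$, $\binom{a}{\le k}:=\sum_{0\le i\le k}\binom{a}{i}$ (sum over integers $i$). The product is over integers $\ell$ with $1\le\ell\le\log C$, and is $1$ if there are none (including $C=0$). Integrality gap: $\mathrm{IPGap}=\mathrm{OPT}(\mathrm{LP})-\mathrm{OPT}(\mathrm{IP})$, where $\mathrm{OPT}(\mathrm{IP})=\max\{\langle c,x\rangle:Ax\le b,\ x\in\{0,1\}^n\}$ and $\mathrm{OPT}(\mathrm{LP})=\max\{\langle c,x\rangle:Ax\le b,\ x\in[0,1]^n\}$. Saddle point: $(x^*,\lambda^* )\in[0,1]^n\times\mathbb{R}^m_{\ge0}$ is a saddle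 point of $\min_{\lambda\ge0}\max_{x\in[0,1]^n}L(x,\lambda)$, where $L(x,\lambda)=\sum_{j\in[n]}(c_j-\langle\lambda,A^j\rangle)x_j+\langle b,\lambda\rangle$: $x^*$ maximizes $L(\cdot,\lambda^* )$ over $[0,1]^n$ and $\lambda^*$ minimizes $L(x^*,\cdot)$ over $\lambda\ge0$. Let $H=\{y\in\mathbb{R}^{m+1}:\langle(1,-\lambda^* ),y\rangle=0\}$ and let $d(z,H)$ be Euclidean distance from $z$ to $H$. For integers $\ell\ge1$, $J_\ell=\{j\in[n]: d((c_j,A^j),H)\in(\tfrac{\log n}{n}2^\ell,\ \tfrac{\log n}{n}2^{\ell+1}]\}$, and $J_{\mathrm{rem}}=[n]\setminus\bigcup_{\ell\ge1}J_\ell$. Best-bound branch-and-bound algorithm: it constructs a binary tree in which each node has an associated LP; the LP of the root is the relaxation with $x\in[0,1]^n$. It starts with no current best feasible solution. An infeasible LP has value $-\infty$. While there are unpruned leaves, each iteration does the following. 1. Select an unpruned leaf $N$ with highest optimal LP value in the current tree, and obtain an optimal solution $\tilde x$ of its LP (if feasible). 2. If $\tilde x$ is integral, and it has higher value than the current best feasible solution (or none exists), set $\tilde x$ as the current best feasible solution; mark $N$ as pruned. 3. Else, if the LP of $N$ is infeasible or its value is strictly less than that of the current best feasible solution, mark $N$ as pruned. 4. Otherwise select any coordinate $j$ where $\tilde x$ is fractional and add two children to $N$: the LP of $N$ with added constraint $x_j=0$, and the LP of $N$ with added constraint $x_j=1$. *)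

(* Defs.v *)
From mathcomp Require Import all_boot all_order all_algebra.
From mathcomp Require Import all_classical all_reals all_analysis.

Set Implicit Arguments.
Unset Strict Implicit.
Unset Printing Implicit Defensive.

Import Order.TTheory GRing.Theory Num.Theory.
Local Open Scope classical_set_scope.
Local Open Scope ring_scope.

Definition dot (R : realType) (k : nat) (u v : 'cV[R]_k) : R :=
  \sum_(i < k) u i 0 * v i 0.

(** The library's norm on matrices is the sup norm. *)
Definition enorm (R : realType) (k : nat) (u : 'cV[R]_k) : R :=
  Num.sqrt (\sum_(i < k) u i 0 ^+ 2).

Definition edist (R : realType) (k : nat) (z : 'cV[R]_k) (H : set 'cV[R]_k) : R :=
  inf [set enorm (z - y) | y in H].

(** [ln] is [0] on nonpositive reals, so no integer [l] satisfies
    [1 <= l <= log2 0]. *)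
Definition log2 (R : realType) (x : R) : R := ln x / ln 2.

(** For [0 <= k], the integers [0 <= i <= k] are those up to [Num.truncn k]. *)
Definition binom_le (R : realType) (a : nat) (k : R) : nat :=
  (\sum_(0 <= i < (Num.truncn k).+1) 'C(a, i))%N.

Definition box (R : realType) (n : nat) : set 'cV[R]_n :=
  [set x : 'cV[R]_n | forall j, 0 <= x j 0 <= 1].

Definition lp_feas (R : realType) (m n : nat) (A : 'M[R]_(m, n)) (b : 'cV[R]_m) :
    set 'cV[R]_n :=
  [set x : 'cV[R]_n | box x /\ forall i, (A *m x) i 0 <= b i 0].

Definition ip_feas (R : realType) (m n : nat) (A : 'M[R]_(m, n)) (b : 'cV[R]_m) :
    set 'cV[R]_n :=
  [set x : 'cV[R]_n | (forall j, x j 0 = 0 \/ x j 0 = 1) /\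
           forall i, (A *m x) i 0 <= b i 0].

(** The value is [-oo] on the empty set; on the nonempty sets considered here
    (closed subsets of the unit cube) the supremum is a maximum. *)
Definition opt (R : realType) (n : nat) (c : 'cV[R]_n) (P : set 'cV[R]_n) : \bar R :=
  ereal_sup [set (dot c x)%:E | x in P].

Definition ip_gap (R : realType) (m n : nat)
    (A : 'M[R]_(m, n)) (b : 'cV[R]_m) (c : 'cV[R]_n) : R :=
  fine (opt c (lp_feas A b)) - fine (opt c (ip_feas A b)).

Definition lagrangian (R : realType) (m n : nat)
    (A : 'M[R]_(m, n)) (b : 'cV[R]_m) (c x : 'cV[R]_n) (lam : 'cV[R]_m) : R :=
  \sum_(j < n) (c j 0 - dot lam (col j A)) * x j 0 + dot b lam.

Definition nonneg (R : realType) (m : nat) : set 'cV[R]_m :=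
  [set lam : 'cV[R]_m | forall i, 0 <= lam i 0].

Definition saddle_point (R : realType) (m n : nat)
    (A : 'M[R]_(m, n)) (b : 'cV[R]_m) (c xs : 'cV[R]_n) (ls : 'cV[R]_m) : Prop :=
  [/\ box xs, nonneg ls,
      forall x, box x -> lagrangian A b c x ls <= lagrangian A b c xs ls &
      forall lam, nonneg lam -> lagrangian A b c xs ls <= lagrangian A b c xs lam].

Definition hyperplane (R : realType) (m : nat) (ls : 'cV[R]_m) : set 'cV[R]_(1 + m) :=
  [set y : 'cV[R]_(1 + m) | dot (col_mx 1%:M (- ls)) y = 0].

Definition item_dist (R : realType) (m n : nat)
    (A : 'M[R]_(m, n)) (c : 'cV[R]_n) (ls : 'cV[R]_m) (j : 'I_n) : R :=
  edist (col_mx (c j 0)%:M (col j A)) (hyperplane ls).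

Definition J (R : realType) (m n : nat)
    (A : 'M[R]_(m, n)) (c : 'cV[R]_n) (ls : 'cV[R]_m) (l : nat) : {set 'I_n} :=
  [set j : 'I_n | log2 n%:R / n%:R * 2 ^+ l < item_dist A c ls j
                                    <= log2 n%:R / n%:R * 2 ^+ l.+1]%SET.

Definition Jrem (R : realType) (m n : nat)
    (A : 'M[R]_(m, n)) (c : 'cV[R]_n) (ls : 'cV[R]_m) : {set 'I_n} :=
  [set j : 'I_n | ~~ `[< exists2 l : nat, (1 <= l)%N & j \in J A c ls l >]]%SET.

(** The two subtrees of [Branch j t0 t1] correspond to the added constraints
    [x_j = 0] and [x_j = 1]. *)
Inductive bbtree (n : nat) : Type :=
| Leaf (pruned : bool)
| Branch (j : 'I_n) (t0 t1 : bbtree n).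

Arguments Leaf {n} pruned.

Fixpoint node_count (n : nat) (t : bbtree n) : nat :=
  match t with
  | Leaf _ => 1
  | Branch _ t0 t1 => (node_count t0 + node_count t1).+1
  end.

(** Nodes are addressed by the sequence of turns leading to them from the root,
    [true] being the turn into the [x_j = 1] child. *)
Fixpoint open_leaf (n : nat) (t : bbtree n) (a : seq bool) : bool :=
  match t, a with
  | Leaf pruned, [::] => ~~ pruned
  | Branch _ t0 t1, s :: a' => open_leaf (if s then t1 else t0) a'
  | _, _ => false
  end.

Fixpoint fixings (n : nat) (t : bbtree n) (a : seq bool) : seq ('I_n * bool) :=
  match t, a with
  | Branch j t0 t1, s :: a' => (j, s) :: fixings (if s then t1 else t0) a'
  | _, _ => [::]
  end.

(** [graft t a u] is [t] with the subtree at address [a] replaced by [u]. *)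
Fixpoint graft (n : nat) (t : bbtree n) (a : seq bool) (u : bbtree n) : bbtree n :=
  match a, t with
  | [::], _ => u
  | false :: a', Branch j t0 t1 => Branch j (graft t0 a' u) t1
  | true :: a', Branch j t0 t1 => Branch j t0 (graft t1 a' u)
  | _ :: _, Leaf _ => t
  end.

Definition node_lp (R : realType) (m n : nat) (A : 'M[R]_(m, n)) (b : 'cV[R]_m)
    (t : bbtree n) (a : seq bool) : set 'cV[R]_n :=
  [set x : 'cV[R]_n | lp_feas A b x /\
           forall f, f \in fixings t a -> x f.1 0 = (f.2 : nat)%:R].

Definition optimal_on (R : realType) (n : nat) (c : 'cV[R]_n) (P : set 'cV[R]_n)
    (x : 'cV[R]_n) : Prop :=
  P x /\ forall y, P y -> dot c y <= dot c x.

Definition integral (R : realType) (n : nat) (x : 'cV[R]_n) : Prop :=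
  forall j, x j 0 \is a Num.int.

(** The current best feasible solution, [None] if there is none. *)
Definition incumbent (R : realType) (n : nat) : Type := option 'cV[R]_n.

Definition improves (R : realType) (n : nat) (c : 'cV[R]_n) (inc : incumbent R n)
    (x : 'cV[R]_n) : Prop :=
  forall z, inc = Some z -> dot c z < dot c x.

Definition dominated (R : realType) (n : nat) (c : 'cV[R]_n) (inc : incumbent R n)
    (P : set 'cV[R]_n) : Prop :=
  exists2 z, inc = Some z & (opt c P < (dot c z)%:E)%E.

Definition selectable (R : realType) (m n : nat)
    (A : 'M[R]_(m, n)) (b : 'cV[R]_m) (c : 'cV[R]_n)
    (t : bbtree n) (a : seq bool) : Prop :=
  open_leaf t a /\
  forall a', open_leaf t a' ->
    (opt c (node_lp A b t a') <= opt c (node_lp A b t a))%E.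

(** One iteration. The choices of the leaf among those of highest LP value, of the
    optimal LP solution and of the branching coordinate are nondeterministic.
    The rule [bb_tie] covers an integral LP solution that merely equals the
    incumbent in value: it does not improve, the node is not dominated, and there
    is no fractional coordinate to branch on, so the node is pruned. *)
Inductive bb_step (R : realType) (m n : nat)
    (A : 'M[R]_(m, n)) (b : 'cV[R]_m) (c : 'cV[R]_n) :
    bbtree n * incumbent R n -> bbtree n * incumbent R n -> Prop :=
| bb_integral t inc a x :
    selectable A b c t a -> optimal_on c (node_lp A b t a) x ->
    integral x -> improves c inc x ->
    bb_step A b c (t, inc) (graft t a (Leaf true), Some x)
| bb_tie t z a x :
    selectable A b c t a -> optimal_on c (node_lp A b t a) x ->
    integral x -> dot c x = dot c z ->
    bb_step A b c (t, Some z) (graft t a (Leaf true), Some z)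
| bb_bound t inc a :
    selectable A b c t a ->
    node_lp A b t a = set0 \/ dominated c inc (node_lp A b t a) ->
    bb_step A b c (t, inc) (graft t a (Leaf true), inc)
| bb_branch t inc a x j :
    selectable A b c t a -> optimal_on c (node_lp A b t a) x ->
    ~ dominated c inc (node_lp A b t a) ->
    x j 0 \isn't a Num.int ->
    bb_step A b c (t, inc) (graft t a (Branch j (Leaf false) (Leaf false)), inc).

(** The states occurring in runs of the algorithm; the tree only grows along a
    run, so a bound on all of them bounds the final tree. *)
Inductive bb_reachable (R : realType) (m n : nat)
    (A : 'M[R]_(m, n)) (b : 'cV[R]_m) (c : 'cV[R]_n) :
    bbtree n * incumbent R n -> Prop :=
| bb_start : bb_reachable A b c (Leaf false, None)
| bb_iter st st' :
    bb_reachable A b c st -> bb_step A b c st st' -> bb_reachable A b c st'.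

(* Main.v *)
Require Import Defs.
From mathcomp Require Import all_boot all_order all_algebra.
From mathcomp Require Import all_classical all_reals all_analysis.
From mathcomp Require Import ring lra.

(** Best-bound selection only branches on nodes whose LP value is at least
    [OPT(IP)]. By Lagrangian duality, fixing coordinates of the set [D] against the
    sign of their reduced costs [c_j - <ls, A^j>] lowers the LP value by at least the
    sum over [D] of the absolute reduced costs, so for a branching node this sum is at
    most the integrality gap. Completing the fixings of a branching node by the signs
    of the reduced costs gives a 0/1 point determined by [D]; as the branching nodes
    consistent with one such point form a path of at most [n] nodes, there are at most
    [n] times as many branching nodes as admissible sets [D]. The distance of an item
    to the hyperplane bounds its absolute reduced cost from below, so an admissible
    [D] has at most [C / 2 ^ l] elements in [J_l], and none if [2 ^ l >= C]. *)

Import Order.TTheory GRing.Theory Num.Theory.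
Local Open Scope classical_set_scope.
Local Open Scope ring_scope.

(** * Trees and the routes of 0/1 points through them *)

Fixpoint branch_count {n : nat} (t : bbtree n) : nat :=
  match t with
  | Leaf _ => 0
  | Branch _ t0 t1 => (branch_count t0 + branch_count t1).+1
  end.

Lemma node_countE {n : nat} (t : bbtree n) :
  node_count t = (2 * branch_count t + 1)%N.
Proof.
elim: t => //= j t0 -> t1 ->.
by rewrite !addn1 addSn addnS mulnS mulnDr.
Qed.

(** The list [F] holds the fixings made above [t], the most recent one first. *)
Fixpoint all_branches {n : nat} (P : seq ('I_n * bool) -> 'I_n -> Prop)
    (F : seq ('I_n * bool)) (t : bbtree n) : Prop :=
  match t with
  | Leaf _ => True
  | Branch j t0 t1 =>
      [/\ P F j, all_branches P ((j, false) :: F) t0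
               & all_branches P ((j, true) :: F) t1]
  end.

Lemma all_branches_impl {n : nat} (P Q : seq ('I_n * bool) -> 'I_n -> Prop) F t :
  (forall F' j, P F' j -> Q F' j) -> all_branches P F t -> all_branches Q F t.
Proof.
move=> PQ; elim: t F => //= j t0 IH0 t1 IH1 F [Pj P0 P1].
by split; [apply: PQ | apply: IH0 | apply: IH1].
Qed.

Lemma all_branches_graft {n : nat} (P : seq ('I_n * bool) -> 'I_n -> Prop) F t a u :
  open_leaf t a -> all_branches P F t ->
  all_branches P (catrev (fixings t a) F) u -> all_branches P F (graft t a u).
Proof.
elim: t F a => [p|j t0 IH0 t1 IH1] F [|s a] //= op [Pj P0 P1] Pu.
by case: s op Pu => op Pu; split => //; [apply: IH1 | apply: IH0].
Qed.

(** The turns a 0/1 point [d] takes down to the leaf whose fixings it satisfies. *)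
Fixpoint route {n : nat} (d : 'I_n -> bool) (t : bbtree n) : seq bool :=
  match t with
  | Leaf _ => [::]
  | Branch j t0 t1 => d j :: (if d j then route d t1 else route d t0)
  end.

Lemma fixings_route {n : nat} (d : 'I_n -> bool) t f :
  f \in fixings t (route d t) -> f.2 = d f.1.
Proof.
elim: t => //= j t0 IH0 t1 IH1.
by case dj: (d j); rewrite inE => /predU1P[->|] /=; rewrite ?dj //.
Qed.

(** Two leaf addresses coincide or part at a branching, so a graft affects only the routes that end
    at [a]. *)
Lemma open_leaf_route_graft {n : nat} (d : 'I_n -> bool) t a u :
  open_leaf t a ->
  open_leaf (graft t a u) (route d (graft t a u)) =
  if a == route d t then open_leaf u (route d u) else open_leaf t (route d t).
Proof.
elim: t a => [p|j t0 IH0 t1 IH1] [|s a] //= op.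
by case: s op => op /=; case dj: (d j); rewrite eqseq_cons //= (IH0, IH1).
Qed.

(** The coordinates branched on along a route are distinct and avoid [F], so each step uses up one
    candidate. *)
Lemma size_route {n : nat} (d : 'I_n -> bool) F t :
  all_branches (fun F' j => j \notin map fst F') F t ->
  (size (route d t) <= #|[set j | j \notin map fst F]%SET|)%N.
Proof.
elim: t F => //= j t0 IH0 t1 IH1 F [jF F0 F1].
rewrite (cardsD1 j) inE jF ltnS.
have E s : [set i | i \notin map fst ((j, s) :: F)]%SET =
           ([set i | i \notin map fst F] :\ j)%SET.
  by apply/setP => i; rewrite !inE /= negb_or.
by case: (d j); [rewrite -(E true); apply: IH1 | rewrite -(E false); apply: IH0].
Qed.

(** Double counting: each branching node lies on the route of some [x] in [X], and the size of a
    route is its number of branching nodes. *)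
Lemma branch_count_le_routes {n : nat} (T : finType) (X : {set T})
    (dir : T -> 'I_n -> bool) F t :
  all_branches (fun F' _ => exists2 x, x \in X & all (fun f => dir x f.1 == f.2) F') F t ->
  (branch_count t <=
     \sum_(x in X | all (fun f => dir x f.1 == f.2) F) size (route (dir x) t))%N.
Proof.
elim: t F => //= j t0 IH0 t1 IH1 F [[x xX xF] /IH0 F0 /IH1 F1].
rewrite (eq_bigr (fun x => 1 + size (if dir x j then route (dir x) t1
                                     else route (dir x) t0)))%N //.
(* The ones count the root, which the witness [x] visits; the rest splits by the turn taken at
   [j]. *)
rewrite big_split /= -add1n leq_add //.
  by rewrite (bigD1 x) /= ?xX ?xF.
rewrite [leqRHS](bigID (fun x => dir x j)) /= addnC leq_add //.
  apply: (leq_trans F1); rewrite leq_eqVlt; apply/orP; left; apply/eqP.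
  apply: congr_big => // y.
    by rewrite /= eqb_id -andbA [X in _ && X]andbC.
  by case/and3P=> _ /eqP->.
apply: (leq_trans F0); rewrite leq_eqVlt; apply/orP; left; apply/eqP.
apply: congr_big => // y.
  by rewrite /= eqbF_neg -andbA [X in _ && X]andbC.
by case/and3P=> _ /eqP->.
Qed.

Lemma node_count_le {n : nat} (T : finType) (X : {set T})
    (dir : T -> 'I_n -> bool) (t : bbtree n) :
  all_branches (fun F j => j \notin map fst F /\
    exists2 x, x \in X & all (fun f => dir x f.1 == f.2) F) [::] t ->
  (node_count t <= 2 * #|X| * n + 1)%N.
Proof.
move=> tX; rewrite node_countE leq_add2r -mulnA leq_mul2l /=.
have tX2 : all_branches (fun F _ =>
    exists2 x, x \in X & all (fun f => dir x f.1 == f.2) F) [::] t.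
  by apply: all_branches_impl tX => F j [].
apply: leq_trans (branch_count_le_routes _ _ _ _ _ tX2) _.
rewrite /= -sum_nat_const (eq_bigl (mem X)) => [|x]; last by rewrite andbT.
apply: leq_sum => x _.
have /(size_route (dir x) [::]) : all_branches (fun F j => j \notin map fst F) [::] t.
  by apply: all_branches_impl tX => F j [].
move=> /leq_trans; apply.
by rewrite -[leqRHS]card_ord max_card.
Qed.

(** * Optima and runs of the algorithm *)

Lemma opt_optimal {R : realType} {n : nat} (c : 'cV[R]_n) P x :
  optimal_on c P x -> opt c P = (dot c x)%:E.
Proof.
case=> Px xmax; apply/eqP; rewrite eq_le; apply/andP; split.
  by apply: ge_ereal_sup => _ [y Py <-]; rewrite lee_fin xmax.
by apply: ereal_sup_ubound; exists x.
Qed.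

Lemma ip_optimum {R : realType} {m n : nat} (A : 'M[R]_(m, n)) b (c : 'cV[R]_n) :
  ip_feas A b !=set0 -> exists y, optimal_on c (ip_feas A b) y.
Proof.
pose vec (S : {set 'I_n}) : 'cV[R]_n := \col_j (j \in S)%:R.
have vecP x : ip_feas A b x -> x = vec [set j | x j 0 == 1]%SET.
  case=> x01 _; apply/colP => j; rewrite mxE inE.
  by case: (x01 j) => ->; rewrite ?eqxx // eq_sym oner_eq0.
pose feas S := `[< ip_feas A b (vec S) >].
case=> x0 x0A; have : feas [set j | x0 j 0 == 1]%SET by apply/asboolP; rewrite -vecP.
case/(arg_maxP (fun S => dot c (vec S))) => S /asboolP fS Smax.
exists (vec S); split=> // y yA; rewrite (vecP y yA).
by apply: Smax; apply/asboolP; rewrite -vecP.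
Qed.

(** [y] stays feasible in an open leaf until the incumbent is at least as good. *)
Lemma bb_reachable_branches {R : realType} {m n : nat}
    (A : 'M[R]_(m, n)) b (c : 'cV[R]_n) y st :
  ip_feas A b y -> bb_reachable A b c st ->
  all_branches (fun F j => exists x,
    [/\ lp_feas A b x, forall f, f \in F -> x f.1 0 = (f.2 : nat)%:R,
        dot c y <= dot c x & x j 0 \isn't a Num.int]) [::] st.1.
Proof.
move=> [y01 yA]; set P := fun _ _ => _.
pose d j := y j 0 == 1.
have yd j : y j 0 = (d j : nat)%:R.
  by rewrite /d; case: (y01 j) => ->; rewrite ?eqxx // eq_sym oner_eq0.
have yroute t : node_lp A b t (route d t) y.
  split=> [|f /fixings_route ->]; last exact: yd.
  by split=> // j; rewrite yd; case: (d j); rewrite ?ler01 lexx.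
pose alive st := open_leaf st.1 (route d st.1) \/
  exists2 z, st.2 = Some z & dot c y <= dot c z.
suff inv : bb_reachable A b c st -> alive st /\ all_branches P [::] st.1.
  by move=> /inv[].
(* Common to the three pruning rules: the incumbent never worsens, and a leaf containing [y] is
   pruned only if the new incumbent is at least as good as [y]. *)
have prune t a inc inc' : open_leaf t a ->
    (node_lp A b t a y -> exists2 z, inc' = Some z & dot c y <= dot c z) ->
    (forall z, inc = Some z -> exists2 z', inc' = Some z' & dot c z <= dot c z') ->
    alive (t, inc) /\ all_branches P [::] t ->
    alive (graft t a (Leaf true), inc') /\
    all_branches P [::] (graft t a (Leaf true)).
  move=> ta ya inc_le [aliv tP]; split; last exact: all_branches_graft.
  case: aliv => [/= open_route|[z /= /inc_le[z' -> zz'] yz]]; last first.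
    by right; exists z' => //; apply: le_trans zz'.
  rewrite /alive /= open_leaf_route_graft //.
  by case: eqP => [aE|_]; [right; apply: ya; rewrite aE | left].
elim=> [|st0 st' _ IH step]; first by split=> //; left.
case: step IH => {st0 st'}.
- move=> t inc0 a x [ta _] [_ xmax] _ imp; apply: prune => //.
    by move=> /xmax; exists x.
  by move=> z /imp /ltW; exists x.
- move=> t z a x [ta _] [_ xmax] _ xz; apply: prune => //.
    by move=> /xmax; rewrite xz; exists z.
  by move=> z' [<-]; exists z.
- move=> t inc0 a [ta _] bound; apply: prune => //; last by move=> z ->; exists z.
  case: bound => [->//|[z incz ltz]] ya; exists z => //.
  rewrite -lee_fin; apply: le_trans (ltW ltz).
  by apply: ereal_sup_ubound; exists y.
- move=> t inc0 a x j [ta amax] xopt ndom xj [aliv tP]; split.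
    case: aliv => [/= open_route|]; last by right.
    left; rewrite /= open_leaf_route_graft //.
    by case: eqP => //= _; case: (d j).
  apply: all_branches_graft => //; split=> //.
  case: (xopt) => [[xA xF] _]; exists x; split=> //.
    by move=> f; rewrite catrevE cats0 mem_rev; apply: xF.
  (* If the leaf of [y] is open, best-bound selection gives the chosen leaf at least its value;
     otherwise the incumbent is as good as [y] and does not dominate the chosen leaf. *)
  case: aliv => [/= open_route|[z /= incz yz]].
    rewrite -lee_fin -(opt_optimal _ _ _ xopt); apply: le_trans (amax _ open_route).
    by apply: ereal_sup_ubound; exists y.
  apply: (le_trans yz); rewrite leNgt; apply/negP => xz; apply: ndom.
  by exists z => //; rewrite (opt_optimal _ _ _ xopt) lte_fin.
Qed.

(** * Counting sets through their traces *)

Lemma card_subsets_le {T : finType} (B : {set T}) k :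
  #|[set S : {set T} | (S \subset B) && (#|S| < k)%N]%SET| =
  (\sum_(0 <= i < k) 'C(#|B|, i))%N.
Proof.
elim: k => [|k IH].
  rewrite big_geq //; apply/eqP; rewrite cards_eq0; apply/eqP/setP => S.
  by rewrite !inE andbF.
rewrite big_nat_recr //= -IH -cards_draws -cardsUI.
rewrite [X in (_ + X)%N]eq_card0 ?addn0 => [|S]; last first.
  by rewrite !inE; case: ltngtP; rewrite ?andbF.
by apply: eq_card => S; rewrite !inE -andb_orr ltnS orbC leq_eqVlt.
Qed.

(** A set [D] covered by [U] and the [B i] is determined by its traces on them. *)
Lemma card_covered_sets_le {T I : finType} (U : {set T}) (B : I -> {set T})
    (k : I -> nat) (X : {set {set T}}) :
  (forall D, D \in X -> D \subset (U :|: \bigcup_i B i)%SET /\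
     forall i, (#|D :&: B i| < k i)%N) ->
  (#|X| <= 2 ^ #|U| * \prod_i \sum_(0 <= l < k i) 'C(#|B i|, l))%N.
Proof.
move=> XP.
pose trace (D : {set T}) := ((D :&: U)%SET, [ffun i => (D :&: B i)%SET]).
pose P i := [set S : {set T} | (S \subset B i) && (#|S| < k i)%N]%SET.
have -> : (2 ^ #|U| * \prod_i \sum_(0 <= l < k i) 'C(#|B i|, l))%N =
          #|finset.setX (powerset U) (setXn P)|.
  rewrite cardsX card_powerset cardsXn; congr muln.
  by apply: eq_bigr => i _; rewrite card_subsets_le.
have traceK D : D \in X -> D = ((trace D).1 :|: \bigcup_i (trace D).2 i)%SET.
  move=> /XP[/finset.setIidPl DE _]; rewrite /trace /=; under eq_bigr do rewrite ffunE.
  by rewrite -big_distrr -finset.setIUr DE.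
have trace_inj : {in X &, injective trace}.
  by move=> D D' /traceK DE /traceK D'E eqD; rewrite DE eqD -D'E.
rewrite -(card_in_imset trace_inj); apply/subset_leq_card.
apply/fintype.subsetP => _ /imsetP[D DX ->].
rewrite finset.in_setX powersetE subsetIr /=; apply/setXnP => i; rewrite ffunE inE subsetIr.
by have [_] := XP D DX; apply.
Qed.

(** * Lagrangian duality at a saddle point *)

Definition reduced_cost {R : realType} {m n : nat} (A : 'M[R]_(m, n)) (c : 'cV[R]_n)
    (ls : 'cV[R]_m) (j : 'I_n) : R :=
  c j 0 - dot ls (col j A).

(** Regrouping by constraints pairs the multipliers with the slack [b - A *m x]. *)
Lemma lagrangianE {R : realType} {m n : nat} (A : 'M[R]_(m, n)) b c x lam :
  lagrangian A b c x lam = dot c x + dot lam (b - A *m x).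
Proof.
rewrite /lagrangian /dot.
under eq_bigr do rewrite mulrBl.
rewrite sumrB -addrA; congr +%R.
under [X in - X]eq_bigr do rewrite mulr_suml.
rewrite exchange_big /= addrC -sumrB; apply: eq_bigr => i _.
rewrite !mxE mulrBr mulrC mulr_sumr; congr (_ - _).
by apply: eq_bigr => j _; rewrite mxE mulrA.
Qed.

Section Saddle.
Context {R : realType} {m n : nat} (A : 'M[R]_(m, n)) (b : 'cV[R]_m).
Context (c xs : 'cV[R]_n) (ls : 'cV[R]_m) (saddle : saddle_point A b c xs ls).

Local Notation rc := (reduced_cost A c ls).

(** Weak duality: multipliers and slacks are nonnegative. *)
Lemma dot_le_lagrangian x : lp_feas A b x -> dot c x <= lagrangian A b c x ls.
Proof.
case: saddle => _ ls0 _ _ [_ xA]; rewrite lagrangianE lerDl.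
by apply: sumr_ge0 => i _; rewrite mulr_ge0 // !mxE subr_ge0; have := xA i; rewrite mxE.
Qed.

(** Raising multiplier [i] by one changes the Lagrangian by the slack of constraint [i], which
    minimality of [ls] makes nonnegative. *)
Lemma saddle_feasible : lp_feas A b xs.
Proof.
case: saddle => xbox ls0 _ lmin; split=> // i.
have /lmin : nonneg (ls + delta_mx i 0).
  by move=> k; rewrite !mxE addr_ge0 // ler0n.
rewrite !lagrangianE lerD2l -subr_ge0 /dot -sumrB.
rewrite (bigD1 i) //= big1 => [|k ki]; rewrite !mxE.
  by rewrite !eqxx /=; lra.
by rewrite (negbTE ki) /= addr0 subrr.
Qed.

(** At the zero multiplier the Lagrangian is the objective. *)
Lemma lagrangian_saddle_le : lagrangian A b c xs ls <= dot c xs.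
Proof.
case: saddle => _ _ _ lmin.
have : lagrangian A b c xs ls <= lagrangian A b c xs 0 by apply: lmin => i; rewrite mxE.
rewrite (lagrangianE A b c xs 0) [X in _ + X]big1 ?addr0 // => i _.
by rewrite mxE mul0r.
Qed.

Lemma saddle_optimal : optimal_on c (lp_feas A b) xs.
Proof.
split=> [|x xA]; first exact: saddle_feasible.
apply: le_trans (dot_le_lagrangian _ xA) (le_trans _ lagrangian_saddle_le).
by case: saddle => _ _ + _; apply; case: xA.
Qed.

(** Compare [x] with the point obtained by flipping its coordinates in [D]. *)
Lemma sum_reduced_cost_le (D : {set 'I_n}) x :
  lp_feas A b x -> {in D, forall j, x j 0 = (~~ (0 < rc j))%:R} ->
  \sum_(j in D) `|rc j| <= dot c xs - dot c x.
Proof.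
move=> xA xD; pose x' : 'cV[R]_n := \col_j if j \in D then (0 < rc j)%R%:R else x j 0.
have x'box : box x'.
  move=> j; rewrite mxE; case: ifP => _; last by case: xA.
  by case: (0 < _); rewrite ?lexx ?ler01.
suff -> : \sum_(j in D) `|rc j| = lagrangian A b c x' ls - lagrangian A b c x ls.
  apply: lerB; last exact: dot_le_lagrangian.
  by apply: le_trans lagrangian_saddle_le; case: saddle => _ _ + _; apply.
rewrite /lagrangian opprD addrACA subrr addr0 -sumrB big_mkcond /=.
apply: eq_bigr => j _; rewrite mxE -mulrBr -/(rc j).
case: ifP => [/xD ->|_]; last by rewrite subrr mulr0.
(* Each flip gains exactly the absolute reduced cost. *)
by case: ltP => r0 /=; [rewrite gtr0_norm | rewrite ler0_norm]; lra.
Qed.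

End Saddle.

(** * Hyperplane distances and the number of admissible sets *)

(** Subtracting the reduced cost from the first entry moves the item into the hyperplane. *)
Lemma item_dist_le {R : realType} {m n : nat} (A : 'M[R]_(m, n)) c ls j :
  item_dist A c ls j <= `|reduced_cost A c ls j|.
Proof.
set r := reduced_cost A c ls j.
pose e : 'cV[R]_(1 + m) := col_mx r%:M 0.
pose z : 'cV[R]_(1 + m) := col_mx (c j 0)%:M (col j A).
have lb : has_lbound [set enorm (z - y) | y in hyperplane ls].
  by exists 0 => _ [y _ <-]; apply: sqrtr_ge0.
apply: ge_inf => //; exists (z - e).
  rewrite /hyperplane /= /dot big_split_ord /= big_ord1.
  under eq_bigr do rewrite opp_col_mx add_col_mx !col_mxEd oppr0 addr0 mxE mulNr.
  rewrite opp_col_mx add_col_mx !col_mxEu !mxE eqxx !mulr1n mul1r sumrN.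
  rewrite /r /reduced_cost /dot.
  lra.
rewrite subKr /enorm big_split_ord /= big_ord1 big1 => [|i _].
  by rewrite addr0 col_mxEu mxE eqxx mulr1n sqrtr_sqr.
by rewrite col_mxEd mxE expr0n.
Qed.

Lemma log2_gt0 {R : realType} (n : nat) : (2 <= n)%N -> 0 < log2 (n%:R : R).
Proof. by move=> n2; rewrite divr_gt0 // ln_gt0 // (ltr_nat _ 1). Qed.

Lemma lt_exp2_log2 {R : realType} (l : nat) (x : R) :
  2 ^+ l < x -> (l <= Num.truncn (log2 x))%N.
Proof.
move=> lx; have x0 : 0 < x by apply: lt_trans lx; rewrite exprn_gt0.
have ln2 : 0 < ln (2 : R) by rewrite ln_gt0 // (ltr_nat _ 1).
have : l%:R < log2 x.
  by rewrite ltr_pdivlMr // mulr_natl -lnXn // ltr_ln ?posrE ?exprn_gt0.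
by move=> lx2; rewrite truncn_ge_nat ltW //; apply: le_lt_trans lx2; rewrite ler0n.
Qed.

Lemma card_disagreements_le {R : realType} {m n : nat} (A : 'M[R]_(m, n)) c ls (g : R)
    (X := [set D : {set 'I_n} | \sum_(j in D) `|reduced_cost A c ls j| <= g]%SET)
    (C := n%:R / log2 n%:R * g) :
  (2 <= n)%N ->
  (#|X| <= 2 ^ #|Jrem A c ls| *
     \prod_(1 <= l < (Num.truncn (log2 C)).+1) binom_le #|J A c ls l| (C / 2 ^+ l))%N.
Proof.
move=> n2; have logn := @log2_gt0 R n n2.
have n0 : (0 : R) < n%:R by rewrite ltr0n; apply: leq_trans n2.
(* Each item of [D] in level [l] has absolute reduced cost above [log2 n / n * 2 ^ l], and these sum
   to at most [g]. *)
have trace_le D l : D \in X -> #|D :&: J A c ls l|%:R * 2 ^+ l <= C.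
  rewrite inE => DX; rewrite /C mulrAC ler_pdivlMr // [leRHS]mulrC -ler_pdivrMr //.
  apply: le_trans DX; rewrite (big_setID (J A c ls l)) /=.
  rewrite -[leLHS]addr0 lerD ?sumr_ge0 //.
  have -> : #|D :&: J A c ls l|%:R * 2 ^+ l * log2 n%:R / n%:R =
           
            \sum_(j in D :&: J A c ls l) (log2 n%:R / n%:R * 2 ^+ l) :> R.
    by rewrite sumr_const -mulr_natl; field; rewrite gt_eqF.
  apply: ler_sum => j; rewrite !inE => /andP[_ /andP[lej _]].
  exact: le_trans (ltW lej) (item_dist_le _ _ _ _).
(* One item suffices here; the inequality is strict because a level excludes its lower end. *)
have level_lt D j l : D \in X -> j \in D -> j \in J A c ls l -> 2 ^+ l < C.
  rewrite !inE => DX jD /andP[lej _].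
  rewrite /C mulrAC ltr_pdivlMr // [ltRHS]mulrC -ltr_pdivrMr // -mulrA mulrC.
  apply: lt_le_trans lej (le_trans (item_dist_le _ _ _ _) (le_trans _ DX)).
  by rewrite (bigD1 j) //= lerDl sumr_ge0.
set L := Num.truncn (log2 C).
rewrite big_add1 /= big_mkord.
apply: card_covered_sets_le => D DX; split=> [|l]; last first.
  have : #|D :&: J A c ls l.+1|%:R <= C / 2 ^+ l.+1.
    by rewrite ler_pdivlMr ?exprn_gt0 // trace_le.
  (* What remains is [0 <= C / 2 ^+ l.+1], needed to compare with the truncation; the cardinality
     bound gives it. *)
  move=> le_card; rewrite ltnS truncn_ge_nat //; exact: le_trans le_card.
apply/fintype.subsetP => j jD; rewrite inE.
have [//|] := boolP (j \in Jrem A c ls); rewrite inE negbK => /asboolP[[//|l] _ jl].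
have lL := lt_exp2_log2 _ _ (level_lt _ _ _ DX jD jl).
by apply/bigcupP; exists (Ordinal lL).
Qed.

Theorem corollary3 (R : realType) (m n : nat)
    (A : 'M[R]_(m, n)) (b : 'cV[R]_m) (c xs : 'cV[R]_n) (ls : 'cV[R]_m)
    (t : bbtree n) (inc : incumbent R n) :
  (1 <= m)%N -> (2 <= n)%N ->
  ip_feas A b !=set0 ->
  saddle_point A b c xs ls ->
  bb_reachable A b c (t, inc) ->
  let C := n%:R / log2 n%:R * ip_gap A b c in
  (node_count t <=
     2 * (2 ^ #|Jrem A c ls| *
          \prod_(1 <= l < (Num.truncn (log2 C)).+1)
             binom_le #|J A c ls l| (C / 2 ^+ l)) * n + 1)%N.
Proof.
move=> _ n2 /(ip_optimum _ _ c)[y yopt] saddle reach /=.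
have gapE : ip_gap A b c = dot c xs - dot c y.
  by rewrite /ip_gap (opt_optimal _ _ _ (saddle_optimal _ _ _ _ _ saddle))
             (opt_optimal _ _ _ yopt).
pose X := [set D : {set 'I_n} |
  \sum_(j in D) `|reduced_cost A c ls j| <= ip_gap A b c]%SET.
apply: (@leq_trans (2 * #|X| * n + 1)%N); last first.
  by rewrite leq_add2r !leq_mul // card_disagreements_le.
pose sgn j := 0 < reduced_cost A c ls j.
(* The 0/1 point of [D] follows the signs of the reduced costs outside [D] and opposes them on
   [D]. *)
apply: (node_count_le _ X (fun D j => (j \in D) (+) sgn j)).
apply: all_branches_impl (bb_reachable_branches _ _ _ _ _ yopt.1 reach).
move=> F j [x [xA xF yx xj]]; split.
  (* A coordinate already fixed is an integer in [x], so [j] is fresh. *)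
  apply: contra xj => /mapP[f /xF + ->] => ->.
  by case: f.2; rewrite ?rpred0 ?rpred1.
pose D := [set i | (i, ~~ sgn i) \in F]%SET.
exists D.
  rewrite inE gapE.
  apply: le_trans (sum_reduced_cost_le _ _ _ _ _ saddle D x xA _) _; last first.
    by rewrite lerD2l lerN2.
  by move=> i; rewrite inE => /xF.
apply/allP => -[i s] isF /=; rewrite inE.
have [isF'|] := boolP ((i, ~~ sgn i) \in F).
  (* [x] satisfies all fixings, so no coordinate is fixed both ways. *)
  have := xF _ isF'; rewrite (xF _ isF) /= => /eqP; rewrite eqr_nat.
  by case: s {isF}; case: (sgn i).
by case: (s =P sgn i) => [->//|]; case: s isF; case: (sgn i) => // ->.
Qed.
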